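(* Let $q=p^m$ be a power of a prime $p$, let $n,r$ be positive integers such that $d:=(nm,r)=(m,r)$, and let $c\in\mathbb{F}_q$ satisfy $N_{q|p^d}(c)=1$. Then $L_{c,r}(x):=x^{p^r}-cx$ induces a permutation of $\ker(T_{q^n|q})$ if and only if $p\nmid n$. In this case a polynomial inducing the inverse map of $L_{c,r}$ restricted to $\ker(T_{q^n|q})$ is \[\sum_{j=0}^{\frac{m}{d}-1}c^{-\frac{p^{(j+1)r}-1}{p^r-1}}\left(n^{-1}\sum_{k=1}^{n-1}k\,x^{p^{\frac{kmr}{d}}}\right)^{p^{jr}}.\]
   Context: For a prime power $Q$ and positive integers $b\mid a$, $T_{Q^a|Q^b}(x)=\sum_{i=0}^{a/b-1}x^{Q^{ib}}$ is the trace map $\mathbb{F}_{Q^a}\to\mathbb{F}_{Q^b}$ and $N_{Q^a|Q^b}(x)=x^{(Q^a-1)/(Q^b-1)}$ the norm map. $\ker(T_{q^n|q})\subseteq\mathbb{F}_{q^n}$ is the kernel of the trace. Integers $n,k$ are viewed in the prime field $\mathbb{F}_p$ and $n^{-1}$ is the inverse there. *)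

(* Defs.v *)
From HB Require Import structures.
From mathcomp Require Import all_boot all_order all_algebra.

Set Implicit Arguments.
Unset Strict Implicit.
Unset Printing Implicit Defensive.

Import GRing.Theory.
Local Open Scope ring_scope.

(* The trace and norm maps F_(Q^a) -> F_(Q^b) for b %| a, with their values
   seen in the field F of order Q^a. *)
Definition trace (F : finFieldType) (Q a b : nat) (x : F) : F :=
  \sum_(i < a %/ b) x ^+ (Q ^ (i * b)).

Definition norm (F : finFieldType) (Q a b : nat) (x : F) : F :=
  x ^+ ((Q ^ a - 1) %/ (Q ^ b - 1)).

Definition ker_trace (F : finFieldType) (Q a b : nat) : {set F} :=
  [set x | trace Q a b x == 0].

Definition induces_permutation (F : finFieldType) (f : {poly F}) (S : {set F})
    : Prop :=
  [/\ {in S, forall x, f.[x] \in S},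
      {in S &, injective (horner f)}
    & {in S, forall y, exists2 x, x \in S & f.[x] = y}].

Definition induces_inverse (F : finFieldType) (f g : {poly F}) (S : {set F})
    : Prop :=
  [/\ {in S, forall x, g.[x] \in S},
      {in S, cancel (horner f) (horner g)}
    & {in S, cancel (horner g) (horner f)}].

Definition binomialL (F : finFieldType) (p r : nat) (c : F) : {poly F} :=
  'X^(p ^ r) - c *: 'X.

(* The natural number divisions below are exact when d %| m and 0 < r;
   k%:R and n%:R^-1 lie in the prime field of F. *)
Definition inverseL (F : finFieldType) (p m n r d : nat) (c : F) : {poly F} :=
  \sum_(0 <= j < m %/ d)
    c ^- ((p ^ (j.+1 * r) - 1) %/ (p ^ r - 1)) *:
      (n%:R^-1 *: \sum_(1 <= k < n) k%:R *: 'X^(p ^ (k * m * r %/ d)))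
        ^+ (p ^ (j * r)).

(* Main.v *)
Require Import Defs.
From HB Require Import structures.
From mathcomp Require Import all_boot all_order all_algebra.
From mathcomp Require Import cyclic finfield.

Set Implicit Arguments.
Unset Strict Implicit.
Unset Printing Implicit Defensive.

Import GRing.Theory.
Local Open Scope ring_scope.

(* Write phi for x |-> x^(p^r), s = m/d and sigma = phi^s, which generates
   Gal(F_(q^n) / F_q). On ker T, summation by parts shows that
   G = n^-1 * sum_k k * sigma^k satisfies sigma G - G = id, and
   L = phi - c telescopes on sum_j c^-(...) * phi^j G, leaving sigma G - G
   because c has norm 1. So the proposed polynomial is a right inverse of L on
   the finite set ker T, hence a two-sided one. If p divides n, then
   c = a^(p^r - 1) for some a in F_q, and a is a nonzero root of L with trace
   n * a = 0. *)

(** Multiplication by a unit [t] permutes the residues modulo [n], and [f] depends only on the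
    residue of its argument. *)
Lemma big_ord_mul_coprime (R : Type) (idx : R) (op : Monoid.com_law idx)
    (n t : nat) (f : nat -> R) :
  coprime n t -> (forall i, f (i %% n)%N = f i) ->
  \big[op/idx]_(i < n) f i = \big[op/idx]_(i < n) f (i * t)%N.
Proof.
case: n => [|n] co_nt fP; first by rewrite !big_ord0.
pose h (i : 'I_n.+1) : 'I_n.+1 := inord ((i * t) %% n.+1).
have hE i : h i = (i * t %% n.+1)%N :> nat by rewrite inordK // ltn_mod.
have wlog_inj (i j : 'I_n.+1) : (i <= j)%N -> h i = h j -> i = j.
  move=> le_ij /(congr1 val)/eqP; rewrite /= !hE eq_sym eqn_mod_dvd.
    rewrite -mulnBl Gauss_dvdl // -eqn_mod_dvd // !modn_small // => /eqP ji.
    by apply: val_inj.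
  by rewrite leq_mul2r le_ij orbT.
have h_inj : injective h.
  move=> i j eq_h; case/orP: (leq_total i j) => le_ij; first exact: wlog_inj.
  exact/esym/wlog_inj.
by rewrite (reindex_inj h_inj); apply: eq_bigr => i _; rewrite hE fP.
Qed.

Lemma expn_gt1 (a k : nat) : (1 < a)%N -> (0 < k)%N -> (1 < a ^ k)%N.
Proof. by move=> a1 k0; rewrite -(exp1n k) ltn_exp2r. Qed.

Lemma geometric_divn (Q k : nat) :
  (1 < Q)%N -> ((Q ^ k - 1) %/ (Q - 1) = \sum_(i < k) Q ^ i)%N.
Proof. by move=> Q1; rewrite !subn1 predn_exp mulKn // -subn1 subn_gt0. Qed.

Lemma expr_iter_fixed (R : pzRingType) (Q k : nat) (x : R) :
  x ^+ Q = x -> x ^+ (Q ^ k) = x.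
Proof. by move=> xQ; elim: k => // k IH; rewrite expnS exprM xQ. Qed.

Lemma expr_modn_fixed (R : pzRingType) (Q n i : nat) (x : R) :
  x ^+ (Q ^ n) = x -> x ^+ (Q ^ (i %% n)) = x ^+ (Q ^ i).
Proof.
move=> xQ; rewrite [in RHS](divn_eq i n) expnD [(_ %/ n * n)%N]mulnC expnM.
by rewrite exprM (expr_iter_fixed _ xQ).
Qed.

(** * Additivity of [p]-power maps in characteristic [p] *)

Section Frobenius.

Variables (p : nat) (R : comNzRingType).
Hypothesis charR : p \in [pchar R].

Lemma pchar_nat_exp k : [pchar R].-nat (p ^ k)%N.
Proof.
by rewrite pnatX (eq_pnat _ (pcharf_eq charR)) pnat_id ?(pcharf_prime charR).
Qed.

Lemma expr_pchar_sum k I s (P : pred I) (F : I -> R) :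
  (\sum_(i <- s | P i) F i) ^+ (p ^ k) = \sum_(i <- s | P i) F i ^+ (p ^ k).
Proof.
apply: (big_morph (fun x => x ^+ (p ^ k))) => [x y|].
  by rewrite exprDn_pchar ?pchar_nat_exp.
by rewrite expr0n expn_eq0 (gtn_eqF (prime_gt0 (pcharf_prime charR))).
Qed.

Lemma expr_pchar_nat k n : (n%:R : R) ^+ (p ^ k) = n%:R.
Proof.
by apply: expr_iter_fixed; rewrite -(pFrobenius_autE charR) pFrobenius_aut_nat.
Qed.

End Frobenius.

(** The nonzero elements are [#|F|.-1] distinct roots of unity of that order, which forces one of
    them to be primitive. *)
Lemma finField_prim_root (F : finFieldType) :
  exists z : F, (#|F|.-1).-primitive_root z.
Proof.
have F1 := finNzRing_gt1 F.
suff /hasP[z _ zP] : has (#|F|.-1).-primitive_root [seq x <- enum F | x != 0].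
  by exists z.
have -> : [seq x <- enum F | x != 0] = enum (predC1 (0 : F)).
  by rewrite enumT; apply: eq_filter.
apply: has_prim_root; rewrite ?enum_uniq //; first by rewrite -subn1 subn_gt0.
  apply/allP => x; rewrite mem_enum inE => x0; apply/unity_rootP.
  by apply: (mulfI x0); rewrite -exprS prednK ?expf_card ?mulr1 // ltnW.
by rewrite -cardE cardC1.
Qed.

(** A multiplicative Hilbert 90: cyclicity of the unit group makes [c] a power of exponent
    [p ^ d - 1], and Bezout passes from [d] to [r]. *)
Lemma exists_root_of_norm1 (F : finFieldType) (p m d r : nat) (c : F) :
  (0 < m)%N -> (0 < r)%N -> #|F| = (p ^ m)%N -> d = gcdn m r ->
  norm p m d c = 1 -> exists2 a : F, a != 0 & a ^+ (p ^ r - 1) = c.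
Proof.
move=> m0 r0 cardF dE normc.
have p1 : (1 < p)%N.
  have := finNzRing_gt1 F; rewrite cardF; case: p {cardF normc} => [|[|//]].
    by rewrite exp0n.
  by rewrite exp1n.
have p0 := ltnW p1.
have d0 : (0 < d)%N by rewrite dE gcdn_gt0 m0.
have [s mE] : exists s, m = (s * d)%N.
  by exists (m %/ d)%N; rewrite divnK // dE dvdn_gcdl.
have gt1 k : (0 < k)%N -> (1 < p ^ k)%N by apply: expn_gt1.
pose N := ((p ^ m - 1) %/ (p ^ d - 1))%N.
have dvd_geom a b : (p ^ a - 1 %| p ^ (b * a) - 1)%N.
  by rewrite mulnC expnM !subn1 [X in (_ %| X)%N]predn_exp dvdn_mulr.
have NE : (N * (p ^ d - 1) = p ^ m - 1)%N by rewrite divnK // mE dvd_geom.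
have N0 : (0 < N)%N.
  by have := gt1 _ m0; rewrite -subn_gt0 -NE muln_gt0 => /andP[].
have [z zP] := finField_prim_root F; rewrite cardF -subn1 in zP.
have [|[i /= _] cE] := prim_rootP zP (x := c).
  by rewrite -NE exprM -/(norm p m d c) normc expr1n.
(* [z ^+ (N * i) = 1], while [z] has order [N * (p ^ d - 1)]. *)
have /dvdnP[t iE] : (p ^ d - 1 %| i)%N.
  rewrite -(dvdn_pmul2l N0) NE (prim_order_dvd zP) mulnC exprM -cE.
  exact/eqP.
have z0 : z != 0.
  apply: contra_eq_neq (prim_expr_order zP) => ->.
  by rewrite expr0n subn_eq0 leqNgt gt1 // eq_sym oner_neq0.
pose b := z ^+ t; have b0 : b != 0 by rewrite expf_neq0.
have bc : b ^+ (p ^ d) = c * b.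
  by rewrite -{1}(subnK (ltnW (gt1 _ d0))) addn1 exprSr -exprM -iE -cE.
(* Here [u * r = d + v * m], and the power [p ^ m] is trivial on [F], so the powers [p ^ (u * r)]
   and [p ^ d] agree on [b]. *)
have [v _ /dvdnP[u uE]] := Bezoutl m r0.
have bur : b ^+ (p ^ (u * r)) = c * b.
  rewrite -uE gcdnC -dE expnD exprM bc mulnC expnM -cardF.
  by rewrite expr_iter_fixed ?expf_card.
exists (b ^+ ((p ^ (u * r) - 1) %/ (p ^ r - 1))); first by rewrite expf_neq0.
rewrite -exprM divnK //; apply: (mulIf b0).
by rewrite -exprSr -addn1 subnK ?expn_gt0 ?p0.
Qed.

Section Inverse.

Variables (p m n r d s t : nat) (F : finFieldType) (c : F).
Hypothesis p_prime : prime p.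
Hypothesis cardF : #|F| = ((p ^ m) ^ n)%N.
Hypotheses (m_gt0 : (0 < m)%N) (r_gt0 : (0 < r)%N) (n_gt0 : (0 < n)%N).
Hypotheses (d_gt0 : (0 < d)%N) (mE : m = (s * d)%N) (rE : r = (t * d)%N).
Hypotheses (co_nt : coprime n t) (co_st : coprime s t).
Hypothesis c_fixed : c ^+ (p ^ m) = c.
Hypothesis norm_c : norm p m d c = 1.

Let q := (p ^ m)%N.
Let S := ker_trace F q n 1.
Let L := binomialL p r c.

Let charF : p \in [pchar F].
Proof. by apply: card_finPcharP p_prime; rewrite cardF -expnM. Qed.

Let expq k (x : F) : x ^+ (q ^ k) = x ^+ (p ^ (m * k)).
Proof. by rewrite -expnM. Qed.

Let mrE : (s * r = m * t)%N.
Proof. by rewrite rE mE mulnA mulnAC. Qed.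

(** * The trace over the subfield of order [q], whose elements are those with [a ^+ q = a], and its
    kernel *)

Lemma traceE (x : F) : trace q n 1 x = \sum_(i < n) x ^+ (q ^ i).
Proof. by rewrite /trace divn1; under eq_bigr do rewrite muln1. Qed.

Lemma trace_fixed (x : F) : x ^+ q = x -> trace q n 1 x = n%:R * x.
Proof.
move=> xq; rewrite traceE; under eq_bigr do rewrite expr_iter_fixed //.
by rewrite sumr_const card_ord mulr_natl.
Qed.

Lemma trace_sum I (u : seq I) (P : pred I) (f : I -> F) :
  trace q n 1 (\sum_(i <- u | P i) f i) = \sum_(i <- u | P i) trace q n 1 (f i).
Proof.
rewrite traceE (eq_bigr _ (fun i _ => traceE (f i))) exchange_big /=.
apply: eq_bigr => i _; rewrite expq (expr_pchar_sum charF).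
by under [RHS]eq_bigr do rewrite expq.
Qed.

Lemma traceM_fixed (a x : F) :
  a ^+ q = a -> trace q n 1 (a * x) = a * trace q n 1 x.
Proof.
move=> aq; rewrite !traceE mulr_sumr.
by apply: eq_bigr => i _; rewrite exprMn expr_iter_fixed.
Qed.

Lemma trace_exp k (x : F) : trace q n 1 (x ^+ (p ^ k)) = trace q n 1 x ^+ (p ^ k).
Proof.
by rewrite !traceE (expr_pchar_sum charF); apply: eq_bigr => i _; rewrite exprAC.
Qed.

Lemma ker_traceM_fixed (a x : F) : a ^+ q = a -> x \in S -> a * x \in S.
Proof. by rewrite !inE => aq /eqP xS; rewrite traceM_fixed // xS mulr0. Qed.

Lemma ker_trace_exp k (x : F) : x \in S -> x ^+ (p ^ k) \in S.
Proof.
rewrite !inE => /eqP xS.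
by rewrite trace_exp xS expr0n expn_eq0 (gtn_eqF (prime_gt0 p_prime)).
Qed.

Lemma ker_trace_sum I (u : seq I) (P : pred I) (f : I -> F) :
  (forall i, P i -> f i \in S) -> \sum_(i <- u | P i) f i \in S.
Proof.
move=> fS; rewrite inE trace_sum big1 // => i /fS.
by rewrite inE => /eqP.
Qed.

Lemma ker_traceB (x y : F) : x \in S -> y \in S -> x - y \in S.
Proof.
(* A two-term sum brings closure under differences back to closure under sums and under scaling by
   [-1], which lies in the subfield of order [q]. *)
move=> xS yS; have -> : x - y = \sum_(i : bool) (if i then x else -1 * y).
  by rewrite big_bool mulN1r.
apply: ker_trace_sum => -[] // _; apply: ker_traceM_fixed => //.
by rewrite exprNn_pchar ?expr1n // (pchar_nat_exp charF).
Qed.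

(* [x |-> x ^+ (q ^ t)] generates the Galois group of F over its subfield of
   order q, because t is prime to n. *)
Lemma trace_coprime (x : F) :
  trace q n 1 x = \sum_(i < n) x ^+ (q ^ (t * i)).
Proof.
rewrite traceE (big_ord_mul_coprime (f := fun i => x ^+ (q ^ i)) _ co_nt).
  by apply: eq_bigr => i _; rewrite mulnC.
by move=> i; rewrite expr_modn_fixed // -cardF expf_card.
Qed.

Let e j := ((p ^ (j * r) - 1) %/ (p ^ r - 1))%N.

Let pr_gt1 : (1 < p ^ r)%N.
Proof. by rewrite expn_gt1 // prime_gt1. Qed.

Let eE j : e j = (\sum_(i < j) (p ^ r) ^ i)%N.
Proof. by rewrite /e mulnC expnM geometric_divn. Qed.

(** Raising [c ^- e j] to the power [p ^ r] and dividing by [c] gives the next coefficient; this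
    recursion drives the telescoping in [inverseLK]. *)
Let eS_mul j : e j.+1 = (1 + e j * p ^ r)%N.
Proof.
rewrite !eE big_ord_recl /= expn0; congr addn.
by rewrite big_distrl; apply: eq_bigr => i _; rewrite /= /bump /= add1n expnSr.
Qed.

Let e1 : e 1 = 1%N.
Proof. by rewrite eE big_ord1. Qed.

Let c_neq0 : c != 0.
Proof.
apply: contra_eq_neq norm_c => ->; rewrite /norm expr0n.
(* The exponent of the norm is positive, so 0 would have norm 0 instead of 1. *)
suff -> : ((p ^ m - 1) %/ (p ^ d - 1) == 0)%N = false by rewrite eq_sym oner_neq0.
have dm : (d <= m)%N.
  by rewrite mE leq_pmull //; case: s mE m_gt0 => // ->.
apply: gtn_eqF; rewrite divn_gt0 ?subn_gt0 ?expn_gt1 ?prime_gt1 //.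
by rewrite leq_sub2r // leq_pexp2l // prime_gt0.
Qed.

(* The exponents r j and d i run through the same residues modulo m. *)
Lemma expr_e_norm : c ^+ e s = 1.
Proof.
have pd1 : (1 < p ^ d)%N by rewrite expn_gt1 // prime_gt1.
rewrite -norm_c /norm {1}mE mulnC expnM geometric_divn // eE !expr_sum.
rewrite (big_ord_mul_coprime (f := fun i => c ^+ ((p ^ d) ^ i)) _ co_st).
  by apply: eq_bigr => i _; rewrite rE -!expnM mulnAC mulnC [(t * i)%N]mulnC.
by move=> i; rewrite expr_modn_fixed // -expnM mulnC -mE.
Qed.

(** The inner sum of [inverseL]: since [r = t * d], its exponent [k * m * r %/ d] equals
    [m * (t * k)]. *)
Definition weighted_sum (x : F) : F :=
  n%:R^-1 * \sum_(1 <= k < n) k%:R * x ^+ (q ^ (t * k)).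

Lemma weighted_sum_ker (x : F) : x \in S -> weighted_sum x \in S.
Proof.
have natq k : (k%:R : F) ^+ q = k%:R by apply: expr_pchar_nat.
move=> xS; apply: ker_traceM_fixed; first by rewrite exprVn natq.
apply: ker_trace_sum => k _; apply: ker_traceM_fixed; first exact: natq.
by rewrite expq; apply: ker_trace_exp.
Qed.

(* Summation by parts gives [n%:R * x - trace x] on the right. *)
Lemma weighted_sum_shift (x : F) : n%:R != 0 :> F -> x \in S ->
  weighted_sum x ^+ (q ^ t) - weighted_sum x = x.
Proof.
move=> n0; rewrite inE trace_coprime.
rewrite -(big_mkord xpredT (fun i => x ^+ (q ^ (t * i)))).
move/eqP => tr0.
have natq k j : (k%:R : F) ^+ (q ^ j) = k%:R by rewrite expq (expr_pchar_nat charF).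
rewrite /weighted_sum exprMn exprVn natq -mulrBr; apply: (canLR (mulKf n0)).
rewrite expq (expr_pchar_sum charF) -sumrB.
pose y k := x ^+ (q ^ (t * k)).
(* The orbit of [x] closes up after [n] steps, which supplies the boundary term of the summation by
   parts. *)
have yn : y n = x by rewrite /y mulnC expnM expr_iter_fixed // -cardF expf_card.
have y0 : y 0%N = x by rewrite /y muln0 expr1.
transitivity (\sum_(1 <= k < n) ((k.+1%:R * y k.+1 - k%:R * y k) - y k.+1)).
  apply: eq_bigr => k _; rewrite exprMn -expq natq -expq -exprM -expnD -mulnSr addrAC.
  by rewrite mulrSr mulrDl mul1r addrK.
rewrite sumrB telescope_sumr // mul1r yn.
(* The sum of [y 1] to [y n] is the trace of [x], hence zero. *)
have -> : \sum_(1 <= i < n) y i.+1 = - y 1%N.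
  apply/eqP; rewrite -addr_eq0 addrC -big_nat_recl // big_nat_recr //= yn addrC.
  by rewrite -y0 -big_ltn // tr0.
by rewrite opprK subrK.
Qed.

(** * The binomial and its right inverse on the kernel *)

Lemma horner_binomialL (x : F) : L.[x] = x ^+ (p ^ r) - c * x.
Proof. by rewrite /L /binomialL !hornerE. Qed.

Lemma binomialL_ker (x : F) : x \in S -> L.[x] \in S.
Proof.
by move=> xS; rewrite horner_binomialL ker_traceB ?ker_trace_exp ?ker_traceM_fixed.
Qed.

Lemma horner_inverseL (x : F) :
  (inverseL p m n r d c).[x] =
    \sum_(0 <= j < s) c ^- e j.+1 * weighted_sum x ^+ (p ^ (r * j)).
Proof.
rewrite /inverseL {1}mE mulnK // horner_sum; apply: eq_bigr => j _.
rewrite hornerZ horner_exp hornerZ horner_sum -/(e j.+1) [(j * r)%N]mulnC.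
congr (_ * (_ * _) ^+ _); apply: eq_bigr => k _; rewrite hornerZ hornerXn.
rewrite expq; congr (_ * x ^+ (p ^ _)).
by rewrite rE mulnA mulnK // mulnAC mulnC [(k * t)%N]mulnC.
Qed.

Lemma inverseL_ker (x : F) : x \in S -> (inverseL p m n r d c).[x] \in S.
Proof.
move=> xS; rewrite horner_inverseL; apply: ker_trace_sum => j _.
apply: ker_traceM_fixed; last exact/ker_trace_exp/weighted_sum_ker.
by rewrite exprVn exprAC c_fixed.
Qed.

Lemma inverseLK (x : F) : n%:R != 0 :> F -> x \in S ->
  L.[(inverseL p m n r d c).[x]] = x.
Proof.
move=> n0 xS; rewrite horner_binomialL horner_inverseL (expr_pchar_sum charF).
pose w := weighted_sum x.
(* Both halves of [L] are sums of [f], shifted by one index, so only [f s - f 0] survives. *)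
pose f j := c * c ^- e j.+1 * w ^+ (p ^ (r * j)).
have -> : \sum_(0 <= j < s) (c ^- e j.+1 * w ^+ (p ^ (r * j))) ^+ (p ^ r)
          = \sum_(0 <= j < s) f j.+1.
  apply: eq_bigr => j _; rewrite exprMn -exprM -expnD -mulnSr exprVn -exprM.
  by rewrite /f (eS_mul j.+1) exprD expr1 invfM mulVKf.
have -> : c * (\sum_(0 <= j < s) c ^- e j.+1 * w ^+ (p ^ (r * j)))
          = \sum_(0 <= j < s) f j.
  by rewrite mulr_sumr; apply: eq_bigr => j _; rewrite /f mulrA.
rewrite -sumrB telescope_sumr // /f e1 muln0 expr1 mulfV // mul1r.
(* The norm condition makes the coefficient of [f s] equal to 1; as [s * r = m * t], the power left
   on [w] is [q ^ t]. *)
rewrite eS_mul exprD expr1 exprM expr_e_norm expr1n mulr1 mulfV // mul1r.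
by rewrite mulnC mrE -expq weighted_sum_shift.
Qed.

End Inverse.

Theorem theorem2p5 (p m q n r d : nat) (p_prime : prime p)
    (m_gt0 : (0 < m)%N) (q_def : q = (p ^ m)%N)
    (n_gt0 : (0 < n)%N) (r_gt0 : (0 < r)%N)
    (d_def : d = gcdn (n * m) r) (d_eq : d = gcdn m r)
    (Fq Fqn : finFieldType) (cardFq : #|Fq| = q) (cardFqn : #|Fqn| = (q ^ n)%N)
    (iota : {rmorphism Fq -> Fqn})
    (c : Fq) (norm_c : norm p m d c = 1) :
  (induces_permutation (binomialL p r (iota c)) (ker_trace Fqn q n 1)
     <-> ~~ (p %| n)%N)
  /\ (~~ (p %| n)%N ->
      induces_inverse (binomialL p r (iota c)) (inverseL p m n r d (iota c))
        (ker_trace Fqn q n 1)).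
Proof.
subst q.
have charF : p \in [pchar Fqn].
  by apply: card_finPcharP p_prime; rewrite cardFqn -expnM.
have d0 : (0 < d)%N by rewrite d_eq gcdn_gt0 m_gt0.
have [s mE] : exists s, m = (s * d)%N by apply/dvdnP; rewrite d_eq dvdn_gcdl.
have [t rE] : exists t, r = (t * d)%N by apply/dvdnP; rewrite d_eq dvdn_gcdr.
(* Dividing [gcdn (n * m) r = d] by [d]; this is where equality of the two gcds enters. *)
have co_nst : coprime (n * s) t.
  move: d_def; rewrite mE rE mulnA -muln_gcdl -{1}[d]mul1n => /eqP.
  by rewrite eqn_pmul2r // eq_sym.
have /andP[co_nt co_st] : coprime n t && coprime s t by rewrite -coprimeMl.
have iota_fixed a : iota a ^+ (p ^ m) = iota a.
  by rewrite -rmorphXn -cardFq expf_card.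
have norm_ic : norm p m d (iota c) = 1.
  by rewrite /norm -rmorphXn -/(norm p m d c) norm_c rmorph1.
set S := ker_trace _ _ _ _; set L := binomialL _ _ _; set G := inverseL _ _ _ _ _ _.
have LS x : x \in S -> L.[x] \in S.
  exact: binomialL_ker.
have GS x : x \in S -> G.[x] \in S.
  exact: (inverseL_ker (s := s) (t := t)).
have GK : ~~ (p %| n)%N -> {in S, cancel (horner G) (horner L)}.
  rewrite (dvdn_pcharf charF) => n0 x xS.
  exact: (inverseLK (s := s) (t := t)).
(* The right inverse makes [L] map the finite set [S] onto itself, hence injectively. *)
have L_inj : ~~ (p %| n)%N -> {in S &, injective (horner L)}.
  move=> n0; apply/imset_injP; suff -> : horner L @: S = S by []; apply/setP => y.
  apply/imsetP/idP => [[x xS ->]|yS]; first exact: LS.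
  by exists G.[y]; rewrite ?GS ?GK.
split; first split.
- move=> [_ inj _]; apply/negP => p_n.
  (* [iota a] is a nonzero root of [L]; its trace [n%:R * iota a] vanishes when [p] divides [n], so
     it collides with 0 inside [S]. *)
  have [a a0 aE] := exists_root_of_norm1 m_gt0 r_gt0 cardFq d_eq norm_c.
  have L0 : L.[iota a] = L.[0].
    rewrite !horner_binomialL mulr0 subr0.
    rewrite -[(p ^ r)%N](@subnK 1) ?expn_gt0 ?prime_gt0 //.
    by rewrite addn1 !exprSr mulr0 -rmorphXn aE subrr.
  have aS : iota a \in S.
    rewrite inE trace_fixed //; move: p_n; rewrite (dvdn_pcharf charF) => /eqP ->.
    by rewrite mul0r.
  have S0 : 0 \in S.
    by rewrite inE trace_fixed ?mulr0 // -(rmorph0 iota) iota_fixed.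
  by move/eqP: (inj _ _ aS S0 L0); rewrite fmorph_eq0 (negPf a0).
- move=> n0; split; [exact: LS | exact: L_inj | move=> y yS].
  by exists G.[y]; [exact: GS | exact: GK].
- move=> n0; split; [exact: GS | move=> x xS | exact: GK].
  (* An injective map with a right inverse is inverted on both sides: compare the images under
     [L]. *)
  by apply: L_inj; rewrite ?GS ?LS // GK ?LS.
Qed.
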